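(* Let $\Gamma$ be a countable (discrete) amenable group. Let $\alpha_X$, $\alpha_Y$ and $\alpha_G$ be actions of $\Gamma$ on compact metrizable spaces $X$, $Y$ and $G$ by homeomorphisms, respectively. If $\alpha_X$ is a $G$-extension of $\alpha_Y$, then $$\mathrm{h}_{\rm top}(\alpha_X)=\mathrm{h}_{\rm top}(\alpha_Y)+\mathrm{h}_{\rm top}(\alpha_G).$$
   Context: $\mathrm{h}_{\rm top}$ is topological entropy for amenable group actions: for a finite open cover $\mathcal{U}$ of $X$, $N(\mathcal{U})$ is the minimal number of elements of $\mathcal{U}$ needed to cover $X$, $\mathcal{U}^F=\bigvee_{\gamma\in F}\gamma^{-1}\mathcal{U}$, $\mathrm{h}_{\rm top}(\alpha,\mathcal{U})=\lim_n\frac{1}{|F_n|}\log N(\mathcal{U}^{F_n})$ along any left Følner sequence $\{F_n\}$ (nonempty finite sets with $|KF_n\Delta F_n|/|F_n|\to0$ for every finite $K\subseteq \Gamma$; the limit exists and does not depend on the choice), and $\mathrm{h}_{\rm top}(\alpha)=\sup_{\mathcal{U}}\mathrm{h}_{\rm top}(\alpha,\mathcal{U})\in[0,\infty]$. A factor map $X\to Y$ is a continuous surjective $\Gamma$-equivariant map. The action $\alpha_X$ is a (right) $G$-extension of $\alpha_Y$ if there are a factor map $\pi:X\to Y$ and a continuous map $X\times G\to X$, $(x,g)\mapsto xg$, such that $\pi^{-1}(\pi(x))=xG$, $xg=xg'$ only when $g=g'$, and $\gamma(xg)=\gamma(x)\gamma(g)$ for all $x\in X$, $g,g'\in G$ and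 $\gamma\in\Gamma$. (No group structure on $G$ is required.) *)

(* Defs.v *)
From HB Require Import structures.
From mathcomp Require Import all_boot all_order all_algebra.
From mathcomp Require Import finmap.
From mathcomp Require Import all_classical all_reals all_analysis.

Set Implicit Arguments.
Unset Strict Implicit.
Unset Printing Implicit Defensive.

Import Order.TTheory GRing.Theory Num.Theory.
Import numFieldTopology.Exports numFieldNormedType.Exports.

Local Open Scope classical_set_scope.
Local Open Scope ring_scope.

Definition metrizable (R : realType) (X : topologicalType) : Prop :=
  exists d : X -> X -> R,
    [/\ forall x y, d x y = 0 <-> x = y,
        forall x y, d x y = d y x,
        forall x y z, d x z <= d x y + d y z
      & forall x (A : set X),
          nbhs x A <-> exists2 e : R, 0 < e & [set y | d x y < e] `<=` A].

(* Groups carry the discrete topology. *)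
Definition left_folner (R : realType) (Gam : groupType)
    (F : nat -> {fset Gam}) : Prop :=
  (forall n, F n != fset0) /\
  (forall K : {fset Gam},
     let KF n := [fset (k * f)%g | k in K, f in F n]%fset in
     (fun n => (#|` ((KF n `\` F n) `|` (F n `\` KF n))%fset |%:R
                / #|` F n|%:R : R)) @ \oo --> (0 : R)).

(* Only meant for countable groups, for which it is equivalent to the
   existence of an invariant mean. *)
Definition amenable (R : realType) (Gam : groupType) : Prop :=
  exists F : nat -> {fset Gam}, left_folner R F.

(* Each [a s] is a homeomorphism, with inverse [a s^-1]. *)
Definition continuous_action (Gam : groupType) (X : topologicalType)
    (a : Gam -> X -> X) : Prop :=
  [/\ forall x, a 1%g x = x,
      forall s t x, a (s * t)%g x = a s (a t x)
    & forall s, continuous (a s)].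

Definition finite_open_cover (X : topologicalType) (U : set (set X)) : Prop :=
  [/\ finite_set U, forall A, U A -> open A & \bigcup_(A in U) A = setT].

Definition subcover_card (X : Type) (U : set (set X)) (n : nat) : Prop :=
  exists V : set (set X),
    [/\ V `<=` U, (V #= `I_n)%card & \bigcup_(A in V) A = setT].

Definition cover_number (X : Type) (U : set (set X)) : nat :=
  get [set n | subcover_card U n /\
               forall m, subcover_card U m -> (n <= m)%N].

(* The join of the covers s^-1 U for s in F: its members are the intersections
   of the sets s^-1 (c s), one c s in U being chosen for every s in F. *)
Definition cover_join (Gam : groupType) (X : Type) (a : Gam -> X -> X)
    (U : set (set X)) (F : {fset Gam}) : set (set X) :=
  [set B | exists2 c : Gam -> set X,
             forall s, s \in F -> U (c s)
           & B = \bigcap_(s in [set` F]) (a s @^-1` c s)].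

(* For a countable amenable group and a finite open cover U, the limit exists
   along every left Folner sequence and does not depend on it. *)
Definition htop_cover (R : realType) (Gam : groupType) (X : topologicalType)
    (a : Gam -> X -> X) (U : set (set X)) : R :=
  get [set l : R | forall F : nat -> {fset Gam}, left_folner R F ->
    (fun n => ln (cover_number (cover_join a U (F n)))%:R / #|` F n|%:R)
      @ \oo --> l].

Definition htop (R : realType) (Gam : groupType) (X : topologicalType)
    (a : Gam -> X -> X) : \bar R :=
  ereal_sup [set (htop_cover R a U)%:E | U in finite_open_cover (X := X)].

Definition factor_map (Gam : groupType) (X Y : topologicalType)
    (aX : Gam -> X -> X) (aY : Gam -> Y -> Y) (p : X -> Y) : Prop :=
  [/\ continuous p, forall y, exists x, p x = y
    & forall s x, p (aX s x) = aY s (p x)].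

(* [m x g] is the product written xg; G need not be a group. *)
Definition is_extension (Gam : groupType) (X Y G : topologicalType)
    (aX : Gam -> X -> X) (aY : Gam -> Y -> Y) (aG : Gam -> G -> G) : Prop :=
  exists (p : X -> Y) (m : X -> G -> X),
    factor_map aX aY p /\
    [/\ continuous (fun z : X * G => m z.1 z.2),
        forall x, p @^-1` [set p x] = range (m x),
        forall x g g', m x g = m x g' -> g = g'
      & forall s x g, aX s (m x g) = m (aX s x) (aG s g)].

(* Main.v *)
(** The lower bound is Bowen's: lifting separated points of [Y] to [X] and
    translating them by separated points of [G] gives separated points of [X].

    For the upper bound, let [U] be an open cover of [X]. Uniform continuity of
    the product gives a cover [W] of [G] such that N(W^K) members of [U^K]
    suffice to cover any fibre of [X -> Y], for every finite [K]. By compactness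
    this remains true of the preimage of every member of [V^K], for a fine
    enough cover [V] of [Y] depending on [K]. The maximal number psi(F) of
    members of [U^F] needed over a member of [V^F] has a subadditive,
    right-invariant logarithm, and N(U^F) <= N(V^F) psi(F). An infimum over one
    [K] does not control the limit of log psi(F_n) / |F_n|; but by the
    Ornstein-Weiss quasi-tilings it is controlled by the values of log psi at
    finitely many tiles, which are chosen before [V]. The same quasi-tilings
    show that the limits defining the entropies exist. *)

Require Import Defs.
From HB Require Import structures.
From mathcomp Require Import all_boot all_order all_algebra.
From mathcomp Require Import finmap.
From mathcomp Require Import all_classical all_reals all_analysis.
From mathcomp Require Import zify lra.

Set Implicit Arguments.
Unset Strict Implicit.
Unset Printing Implicit Defensive.

Import Order.TTheory GRing.Theory Num.Theory.
Import numFieldTopology.Exports numFieldNormedType.Exports.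

Local Open Scope classical_set_scope.
Local Open Scope ring_scope.

(** * Quasi-tilings and the Ornstein-Weiss lemma *)

Section Tiling.
Variables (R : realType) (Gam : groupType).
Implicit Types (A B F K T D : {fset Gam}) (c d k s : Gam).

(** On the right, so as to commute with the left multiplications in [exits] and in the Folner
    condition. *)
Definition translate F s : {fset Gam} := [fset (f * s)%g | f in F]%fset.

Definition exits d F : {fset Gam} := [fset c in F | (d * c)%g \notin F]%fset.

(** Small relative to the size of [F] when [F] is almost invariant under [D]; a point is counted
    once for each [d] that moves it out. *)
Definition boundary D F : nat := (\sum_(d <- D) #|` exits d F|)%N.

Lemma translateE F s x : (x \in translate F s) = ((x * s^-1)%g \in F).
Proof.
apply/imfsetP/idP => [[f fF ->]|xF]; first by rewrite mulgK.
by exists (x * s^-1)%g; rewrite // mulgVK.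
Qed.

Lemma card_translate F s : #|` translate F s| = #|` F|.
Proof. by rewrite card_imfset //; apply: mulIg. Qed.

Lemma card_exits_translate d F s :
  (#|` exits d (translate F s)| <= #|` exits d F|)%N.
Proof.
rewrite -(card_translate (exits d F) s); apply: fsubset_leq_card.
apply/fsubsetP => x; rewrite translateE !inE !translateE => /andP[-> h] /=.
by rewrite mulgA.
Qed.

(** A point leaving the difference either exits [A] or enters [B]. As left multiplication by [d] is
    injective and [B] is finite, as many points enter [B] as exit it. *)
Lemma card_exits_diff d A B :
  (#|` exits d (A `\` B)%fset| <= #|` exits d A| + #|` exits d B|)%N.
Proof.
pose B' := [fset (d^-1 * x)%g | x in B]%fset.
have inB' x : (x \in B') = ((d * x)%g \in B).
  apply/imfsetP/idP => [[b bB ->]|xB]; first by rewrite mulVKg.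
  by exists (d * x)%g; rewrite // mulKg.
have cB' : #|` B'| = #|` B| by rewrite card_imfset //; apply: mulgI.
have -> : #|` exits d B| = #|` (B' `\` B)%fset|.
  have -> : exits d B = (B `\` B')%fset.
    by apply/fsetP => x; rewrite !inE inB' andbC.
  by rewrite !cardfsD cB' fsetIC.
rewrite (leq_trans _ (leq_card_fsetU _ _)) //.
apply/fsubset_leq_card/fsubsetP => x; rewrite !inE inB' => /andP[/andP[xB ->]].
by rewrite xB; do 2 case: (_ \in _).
Qed.

Lemma boundary_diff_translate D F A K c :
  (boundary D (F `\` (A `|` translate K c))%fset <=
   boundary D (F `\` A)%fset + boundary D K)%N.
Proof.
rewrite /boundary -big_split leq_sum // => d _; rewrite -fsetDDl.
by rewrite (leq_trans (card_exits_diff _ _ _)) //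
  leq_add2l card_exits_translate.
Qed.

Lemma card_fset_filter (A : {fset Gam}) (P : pred Gam) :
  #|` [fset x in A | P x]%fset| = (\sum_(x <- A) P x)%N.
Proof.
rewrite card_fset_sum1 -big_fset_condE /= big_mkcond /=.
by apply: eq_bigr => x _; case: (P x).
Qed.

(** If the tile at a point [c] of [F] is not inside [F], some [k] in [K] moves [c] out of [F], so
    [c] is counted in the boundary. *)
Lemma card_interior F K :
  (#|` F| <= #|` [fset c in F | (translate K c `<=` F)%fset]%fset| +
   boundary K F)%N.
Proof.
rewrite /boundary card_fset_filter.
under [X in (_ <= _ + X)%N]eq_bigr => d _ do rewrite card_fset_filter.
rewrite exchange_big /= -big_split card_fset_sum1 big_seq [leqRHS]big_seq.
apply: leq_sum => c cF.
have [//|/fsubsetPn[x]] := boolP (translate K c `<=` F)%fset.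
move=> /imfsetP[k /= kK ->] kcF; rewrite (big_fsetD1 k) //=.
by rewrite kcF.
Qed.

(* If every interior tile met [A] in at least [e #|K|] points, then counting
   the pairs (tile, point of the tile in [A]) in two ways would give
   [e #|K| * #interior <= #|K| * #|A|]. *)
Lemma small_overlap (e : R) F K A : 0 <= e -> K != fset0 ->
  #|` A|%:R < e * (#|` F|%:R - (boundary K F)%:R) ->
  exists2 c, (translate K c `<=` F)%fset &
    #|` (translate K c `&` A)%fset|%:R < e * #|` K|%:R.
Proof.
move=> e0; rewrite -cardfs_gt0 => K0 Alt; apply: contrapT => nex.
set I := [fset c in F | (translate K c `<=` F)%fset]%fset.
have cI : #|` F|%:R - (boundary K F)%:R <= #|` I|%:R :> R.
  by rewrite lerBlDr -natrD ler_nat card_interior.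
have up : (\sum_(c <- I) #|` (translate K c `&` A)%fset| <= #|` K| * #|` A|)%N.
  rewrite (eq_bigr (fun c => \sum_(k <- K) ((k * c)%g \in A))%N); last first.
    move=> c _; rewrite -card_fset_filter -[RHS](card_translate _ c).
    congr (#|` _|); apply/fsetP => x.
    by rewrite !inE !translateE !inE mulgVK.
  rewrite exchange_big /= card_fset_sum1 big_distrl /= leq_sum // => k _.
  rewrite mul1n -card_fset_filter; set J := [fset x in I | _]%fset.
  have <- : #|` [fset (k * x)%g | x in J]%fset| = #|` J|.
    by rewrite card_imfset //; apply: mulgI.
  apply/fsubset_leq_card/fsubsetP => x /imfsetP[y /=]; rewrite !inE.
  by move=> /andP[_ ?] ->.
have lo : #|` I|%:R * (e * #|` K|%:R) <=
    (\sum_(c <- I) #|` (translate K c `&` A)%fset|)%:R :> R.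
  rewrite natr_sum card_fset_sum1 natr_sum mulr_suml big_seq [leRHS]big_seq.
  apply: ler_sum => c; rewrite !inE => /andP[_ cF]; rewrite mul1r leNgt.
  by apply/negP => lt; apply: nex; exists c.
have : #|` A|%:R * #|` K|%:R < #|` A|%:R * #|` K|%:R :> R.
  rewrite (lt_le_trans (y := e * #|` I|%:R * #|` K|%:R)) //.
    rewrite ltr_pM2r ?ltr0n // (lt_le_trans Alt) // ler_wpM2l //.
  rewrite mulrAC mulrC (le_trans lo) // mulrC -natrM ler_nat //.
by rewrite ltxx.
Qed.

Definition subadditive_invariant (phi : {fset Gam} -> R) :=
  [/\ phi fset0 <= 0, forall A B, phi (A `|` B)%fset <= phi A + phi B
    & forall A s, phi (translate A s) <= phi A].

(** Greedy choice: while [A] is too small, [small_overlap] supplies one more tile, which brings at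
    least [(1 - e) |K|] new points. Here [n] counts the tiles. *)
Lemma partial_tiling (e : R) F K : 0 < e < 1 -> K != fset0 ->
  exists (n : nat) A,
  [/\ (A `<=` F)%fset, n%:R * ((1 - e) * #|` K|%:R) <= #|` A|%:R,
     e * (#|` F|%:R - (boundary K F)%:R) <= #|` A|%:R,
     forall D, (boundary D (F `\` A)%fset <= boundary D F + n * boundary D K)%N
   & forall phi, subadditive_invariant phi -> phi A <= n%:R * phi K].
Proof.
move=> /andP[e0 e1] K0.
pose P (n : nat) A :=
  [/\ (A `<=` F)%fset, n%:R * ((1 - e) * #|` K|%:R) <= #|` A|%:R,
     forall D, (boundary D (F `\` A)%fset <= boundary D F + n * boundary D K)%N
   & forall phi, subadditive_invariant phi -> phi A <= n%:R * phi K].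
(* [m] bounds the number of uncovered points; every added tile lowers it. *)
suff grow m n A : (#|` F| - #|` A| <= m)%N -> P n A ->
    exists n A, P n A /\ e * (#|` F|%:R - (boundary K F)%:R) <= #|` A|%:R.
  have [||n [A [[AF nA bA pA] eA]]] := grow #|` F| 0%N fset0.
  - by rewrite cardfs0 subn0.
  - split=> [||D|phi [phi0 _ _]]; rewrite ?fsub0set ?mul0r ?mul0n ?addn0 ?fsetD0 //.
  - by exists n, A.
elim: m n A => [|m IHm] n A mA PA.
  have [AF _ _ _] := PA; exists n, A; split=> //.
  have -> : A = F.
    by apply/eqP; rewrite eqEfcard AF; move: mA; rewrite leqn0 subn_eq0.
  rewrite (le_trans (y := e * #|` F|%:R)) //.
    by apply: ler_wpM2l; [exact: ltW|rewrite lerBlDr lerDl].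
  by apply: ler_piMl => //; exact: ltW.
have [le_eA|lt_Ae] := leP (e * (#|` F|%:R - (boundary K F)%:R)) #|` A|%:R.
  by exists n, A.
have [c KcF small] := small_overlap (ltW e0) K0 lt_Ae.
have [AF nA bA pA] := PA.
have cardU : #|` A|%:R + (1 - e) * #|` K|%:R <=
    #|` (A `|` translate K c)%fset|%:R :> R.
  rewrite -(lerD2r #|` (A `&` translate K c)%fset|%:R) -natrD cardfsUI.
  rewrite natrD card_translate -addrA lerD2l fsetIC; lra.
have K1 : 0 < #|` K|%:R :> R by rewrite ltr0n cardfs_gt0.
apply: (IHm n.+1 (A `|` translate K c)%fset).
  have : (#|` A| < #|` (A `|` translate K c)%fset|)%N.
    rewrite -(ltr_nat R) (lt_le_trans _ cardU) // ltrDl mulr_gt0 //; lra.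
  by lia.
split.
- by rewrite fsubUset AF.
- by rewrite (le_trans _ cardU) // -natr1 mulrDl mul1r lerD2r.
- move=> D; rewrite (leq_trans (boundary_diff_translate _ _ _ _ _)) //.
  by rewrite mulSnr addnA leq_add2r.
- move=> phi phiP; have [_ sub inv] := phiP.
  by rewrite (le_trans (sub _ _)) // -natr1 mulrDl mul1r lerD ?pA.
Qed.

(** Induction on the tiles, the head being placed first and almost invariant under the later ones.
    [f] is the size of the original set and [F] what is left of it; the boundary may grow by
    [2 * del] for each point removed. While [F] exceeds [eta * f], each round removes at least the
    share [e / 2] of it. *)
Lemma quasi_tiling (e eta del f : R) (L : seq {fset Gam}) F :
    0 < e <= 2^-1 -> 0 < del -> 6 * del <= eta ->
    (forall K, K \in L -> K != fset0) ->
    pairwise (fun K K' => (boundary K' K)%:R <= del * #|` K|%:R) L ->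
    #|` F|%:R <= f ->
    (forall K, K \in L ->
       (boundary K F)%:R <= del * f + 2 * del * (f - #|` F|%:R)) ->
  exists F', [/\ (F' `<=` F)%fset,
    #|` F'|%:R <= Num.max (eta * f) ((1 - e / 2) ^+ size L * #|` F|%:R) &
    forall phi (m : R), subadditive_invariant phi -> 0 <= m ->
      (forall K, K \in L -> phi K <= m * #|` K|%:R) ->
      phi F <= (1 + 2 * e) * m * (#|` F|%:R - #|` F'|%:R) + phi F'].
Proof.
move=> /andP[e0 e12] del0 deleta.
elim: L F => [|K L IHL] F L0 pwL Ff bF.
  exists F; split=> // [|phi m _ _ _]; last by rewrite subrr mulr0 add0r.
  by rewrite le_max expr0 mul1r lexx orbT.
have [smallF|bigF] := leP #|` F|%:R (eta * f).
  exists F; split=> // [|phi m _ _ _]; last by rewrite subrr mulr0 add0r.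
  by rewrite le_max smallF.
have K0 : K != fset0 by apply: L0; rewrite mem_head.
have e01 : 0 < e < 1 by rewrite e0 /= (le_lt_trans e12) // invf_lt1 ?ltr1n.
have [n [A [AF nA eA bA phiA]]] := partial_tiling F e01 K0.
have f0 : 0 <= f by rewrite (le_trans _ Ff).
(* The boundary is at most [3 * del * f], hence at most [eta * f / 2], while [F] has more than
   [eta * f] points. *)
have bKF : (boundary K F)%:R <= #|` F|%:R / 2 :> R.
  have := bF K (mem_head _ _).
  have : 6 * del * f <= eta * f by rewrite ler_wpM2r.
  have : del * #|` F|%:R >= 0 by rewrite mulr_ge0 // ltW.
  by lra.
have AleF : #|` A|%:R <= #|` F|%:R :> R by rewrite ler_nat fsubset_leq_card.
have cardD : #|` (F `\` A)%fset|%:R = #|` F|%:R - #|` A|%:R :> R.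
  by rewrite cardfsDS // natrB // fsubset_leq_card.
(* For [e <= 1/2] the product of [1 - e] and [1 + 2 * e] is at least 1, so overlaps cost only the
   factor [1 + 2 * e]. *)
have nK : n%:R * #|` K|%:R <= (1 + 2 * e) * #|` A|%:R :> R.
  have h : 0 <= 1 + 2 * e by lra.
  have := ler_wpM2l h nA.
  have : 0 <= (e * (1 - 2 * e)) * (n%:R * #|` K|%:R).
    by rewrite !mulr_ge0 //; lra.
  by lra.
have nK2 : n%:R * #|` K|%:R <= 2 * #|` A|%:R :> R.
  by rewrite (le_trans nK) // ler_wpM2r //; lra.
move: pwL; rewrite pairwise_cons => /andP[/allP pwK pwL].
have [||||F' [F'F cF' phiF']] := IHL (F `\` A)%fset.
- by move=> K' K'L; apply: L0; rewrite inE K'L orbT.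
- by [].
- by rewrite cardD (le_trans _ Ff) // gerBl.
(* Removing [A] raises the allowance by [2 * del * |A|], which pays for the boundaries of the [n]
   tiles. *)
- move=> K' K'L; rewrite cardD.
  have h1 : (boundary K' (F `\` A)%fset)%:R <=
      (boundary K' F)%:R + n%:R * (boundary K' K)%:R :> R.
    by rewrite -natrM -natrD ler_nat.
  have h2 := bF K' (mem_behead (s := K :: L) K'L).
  have h3 : n%:R * (boundary K' K)%:R <= n%:R * (del * #|` K|%:R).
    by rewrite ler_wpM2l // pwK.
  have h4 : del * (n%:R * #|` K|%:R) <= del * (2 * #|` A|%:R).
    by rewrite ler_wpM2l // ltW.
  lra.
exists F'; split.
- by rewrite (fsubset_trans F'F) // fsubsetDl.
- rewrite (le_trans cF') // ge_max !le_max lexx /=; apply/orP; right.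
  rewrite exprSr -mulrA ler_wpM2l ?exprn_ge0 //; first by lra.
  rewrite cardD.
  have := ler_wpM2l (ltW e0) bKF.
  by lra.
- move=> phi m phiP m0 phiL.
  have [_ sub _] := phiP.
  have AFE : (F `&` A)%fset = A by apply/fsetIidPr.
  have := sub A (F `\` A)%fset; rewrite -{1}AFE fsetID => h0.
  have h1 : phi (F `\` A)%fset <= _ := phiF' phi m phiP m0
    (fun K' K'L => phiL K' (mem_behead (s := K :: L) K'L)).
  have h2 := phiA _ phiP.
  have h3 : n%:R * phi K <= n%:R * (m * #|` K|%:R).
    by rewrite ler_wpM2l // phiL ?mem_head.
  have h4 : m * (n%:R * #|` K|%:R) <= m * ((1 + 2 * e) * #|` A|%:R).
    by rewrite ler_wpM2l.
  rewrite cardD in h1.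
  lra.
Qed.

(** The tiles must satisfy a numerical bound besides being almost invariant; [T] is the set of those
    that do. *)
Definition folner_family (T : set {fset Gam}) :=
  forall D (del : R), 0 < del ->
  exists K, [/\ T K, K != fset0 & (boundary D K)%:R <= del * #|` K|%:R].

Lemma boundary_mono D D' F : (D `<=` D')%fset ->
  (boundary D F <= boundary D' F)%N.
Proof.
move=> /fsubsetP DD'; rewrite /boundary.
have -> : (\sum_(d <- D) #|` exits d F| =
    \sum_(d <- D' | d \in D) #|` exits d F|)%N.
  rewrite [RHS]big_fset_condE; apply: eq_fbigl => x; rewrite !inE.
  by case: (boolP (x \in D)) => [/DD' ->|]; rewrite ?andbF.
by rewrite big_mkcond leq_sum // => d _; case: ifP.
Qed.

(** Each new tile is chosen almost invariant under the union of the earlier ones and put at the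
    head. *)
Lemma folner_family_chain (T : set {fset Gam}) (del : R) N :
  folner_family T -> 0 < del ->
  exists L : seq {fset Gam},
  [/\ size L = N, forall K, K \in L -> T K /\ K != fset0
    & pairwise (fun K K' => (boundary K' K)%:R <= del * #|` K|%:R) L].
Proof.
move=> FT del0; elim: N => [|N [L [<- LT pwL]]]; first by exists [::].
have [K [TK K0 bK]] := FT (\bigcup_(K <- L) K)%fset _ del0.
exists (K :: L); split=> // [K'|]; first by rewrite inE => /predU1P[->|/LT].
rewrite pairwise_cons pwL andbT; apply/allP => K' K'L.
rewrite (le_trans _ bK) // ler_nat boundary_mono //.
exact: bigfcup_sup.
Qed.

Lemma subadditive_invariant_card phi (M : R) F : subadditive_invariant phi ->
  phi [fset 1%g]%fset <= M -> phi F <= M * #|` F|%:R.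
Proof.
move=> [phi0 sub inv] phi1.
elim/finSet_rect: F => F IHF.
have [->|[x xF]] := fset_0Vmem F; first by rewrite cardfs0 mulr0.
rewrite -(fsetD1K xF) (le_trans (sub _ _)) // cardfsU1 !inE eqxx /=.
rewrite natrD mulrDr mulr1 lerD ?IHF ?fproperD1 //.
have -> : [fset x]%fset = translate [fset 1%g]%fset x.
  apply/fsetP => y; rewrite translateE !inE; apply/eqP/eqP => [->|h].
    by rewrite mulgV.
  by rewrite -[y](mulgVK x) h mul1g.
by rewrite (le_trans (inv _ _)).
Qed.

(** The tiles and the thresholds are fixed before [phi], so that [phi] may later depend on them. The
    untiled rest, a share of at most [eps], is estimated point by point with [M]. *)
Lemma quasi_tiling_bound (T : set {fset Gam}) (eps : R) :
  folner_family T -> 0 < eps ->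
  exists L : seq {fset Gam}, (forall K, K \in L -> T K /\ K != fset0) /\
  exists D (del : R), 0 < del /\
  forall F, (boundary D F)%:R <= del * #|` F|%:R ->
  forall phi (m M : R), subadditive_invariant phi -> 0 <= m -> 0 <= M ->
    (forall K, K \in L -> phi K <= m * #|` K|%:R) ->
    phi [fset 1%g]%fset <= M ->
    phi F <= ((1 + eps) * m + eps * M) * #|` F|%:R.
Proof.
move=> FT eps0.
(* [quasi_tiling] asks for [e <= 1/2]; [2 * e <= eps] turns its factor into [1 + eps]. *)
pose e : R := Num.min 2^-1 (eps / 2).
have e0 : 0 < e by rewrite lt_min invr_gt0 ltr0n divr_gt0.
have e12 : e <= 2^-1 by rewrite ge_min lexx.
have eeps : 2 * e <= eps.
  have : e <= eps / 2 by rewrite ge_min lexx orbT.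
  by lra.
(* [N] tiles suffice to bring the uncovered share down to [eps]. *)
have [N small] : exists N, (1 - e / 2) ^+ N <= eps.
  have : (fun N => (1 - e / 2) ^+ N) @ \oo --> (0 : R).
    by apply: cvg_expr; rewrite ger0_norm; lra.
  by move=> /cvgr_le /(_ _ eps0)[N _ /(_ N (leqnn N))]; exists N.
have del0 : 0 < eps / 6 by rewrite divr_gt0.
have [L [sL LT pwL]] := folner_family_chain N FT del0.
exists L; split=> //.
exists (\bigcup_(K <- L) K)%fset, (eps / 6); split=> //.
move=> F bF phi m M phiP m0 M0 phiL phi1.
have [||||F' [F'F cF' phiF]] :=
    @quasi_tiling e eps (eps / 6) #|` F|%:R L F _ del0 _ _ pwL (lexx _).
- by rewrite e0.
- by lra.
- by move=> K /LT[].
- move=> K KL; rewrite subrr mulr0 addr0 (le_trans _ bF) // ler_nat.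
  by rewrite boundary_mono // bigfcup_sup.
rewrite (le_trans (phiF _ _ phiP m0 phiL)) // [leRHS]mulrDl lerD //.
  rewrite ler_pM ?mulr_ge0 ?subr_ge0 ?ler_nat ?fsubset_leq_card //; try lra.
    by rewrite ler_wpM2r //; lra.
  by rewrite gerBl.
rewrite (le_trans (subadditive_invariant_card _ phiP phi1)) //.
rewrite [eps * M]mulrC -mulrA ler_wpM2l // (le_trans cF') //.
rewrite ge_max lexx /= sL ler_wpM2r //.
Qed.

End Tiling.

(** * Convergence along Folner sequences *)

Section OrnsteinWeiss.
Variables (R : realType) (Gam : groupType).
Implicit Types (F K D : {fset Gam}) (phi : {fset Gam} -> R).

(** Multiplication by [d] sends [exits d F] injectively into the part of [DF] outside [F], so the
    boundary is at most [|D|] times the symmetric difference. *)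
Lemma left_folner_boundary (F : nat -> {fset Gam}) D (del : R) :
  left_folner R F -> 0 < del ->
  \forall n \near \oo, (boundary D (F n))%:R <= del * #|` F n|%:R.
Proof.
move=> [F0 /(_ D) /= FD] del0.
(* Adding 1 keeps the denominator positive when [D] is empty. *)
have D1 : 0 < #|` D|%:R + 1 :> R by rewrite ltr_wpDl.
have e0 : 0 < del / (#|` D|%:R + 1) by rewrite divr_gt0.
apply: filterS (cvgr_le _ FD _ e0) => n.
have Fn : 0 < #|` F n|%:R :> R by rewrite ltr0n cardfs_gt0.
rewrite ler_pdivrMr // mulrAC ler_pdivlMr // => h; rewrite (le_trans _ h) //.
rewrite mulrDr mulr1 ler_wpDr // -natrM ler_nat /boundary mulnC.
rewrite [X in (_ <= X * _)%N]card_fset_sum1 big_distrl /=.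
rewrite big_seq [leqRHS]big_seq; apply: leq_sum => d dD; rewrite mul1n.
have <- : #|` [fset (d * x)%g | x in exits d (F n)]%fset| = #|` exits d (F n)|.
  by rewrite card_imfset //; apply: mulgI.
apply/fsubset_leq_card/fsubsetP => x /imfsetP[y /=]; rewrite !inE.
move=> /andP[yF dyF] ->; rewrite dyF /=; apply/orP; left.
by apply/imfset2P; exists d => //; exists y.
Qed.

Lemma left_folner_family (F : nat -> {fset Gam}) (T : set {fset Gam}) :
  left_folner R F -> (\forall n \near \oo, T (F n)) -> folner_family R T.
Proof.
move=> FF TF D del del0.
have [N _ /(_ N (leqnn N))[TN bN]] := filterI TF (left_folner_boundary D FF del0).
by exists (F N); split=> //; case: FF.
Qed.

(** The limit is the infimum of the [m] for which the sets with [phi K <= m * |K|] form a Folner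
    family. Quasi-tiling by such sets bounds the ratios from above; a value below the infimum is
    exceeded on all sufficiently invariant sets. *)
Lemma ornstein_weiss phi : amenable R Gam -> subadditive_invariant phi ->
  (forall K, 0 <= phi K) ->
  exists l : R, forall F : nat -> {fset Gam}, left_folner R F ->
    (fun n => phi (F n) / #|` F n|%:R) @ \oo --> l.
Proof.
move=> [F1 FF1] phiP phi0.
pose below m := [set K | phi K <= m * #|` K|%:R].
pose S := [set m | folner_family R (below m)].
have S_lb m : S m -> 0 <= m.
  move=> /(_ fset0 1 ltr01)[K [/= Km K0 _]].
  have K1 : 0 < #|` K|%:R :> R by rewrite ltr0n cardfs_gt0.
  by rewrite -(pmulr_lge0 _ K1) (le_trans _ Km).
have S_inf : has_inf S.
  split; last by exists 0 => m /S_lb.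
  exists (phi [fset 1%g]%fset); apply: (left_folner_family FF1).
  by near=> n; apply: subadditive_invariant_card.
exists (inf S) => F FF; apply/cvgrPdist_le => e e0.
set M := phi [fset 1%g]%fset.
have M0 : 0 <= M by exact: phi0.
have e20 : 0 < e / 2 by rewrite divr_gt0.
have [m Sm minf] := inf_adherent e20 S_inf.
have m0 : 0 <= m := S_lb _ Sm.
have mM : 0 < m + M + 1 by rewrite ltr_wpDl ?addr_ge0.
(* With this share the tiling error, a multiple of [m + M], is at most [e / 2]; the other half
   covers [m - inf S]. *)
have d0 : 0 < e / 2 / (m + M + 1) by rewrite divr_gt0.
have [L [LT [D [del [del0 up]]]]] := quasi_tiling_bound Sm d0.
have nS : ~ S (inf S - e).
  by move=> /(ge_inf (proj2 S_inf)); lra.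
have [D' [del' [del'0 lo]]] : exists D (del : R), 0 < del /\
    forall K, K != fset0 -> (boundary D K)%:R <= del * #|` K|%:R ->
      (inf S - e) * #|` K|%:R < phi K.
  apply: contrapT => h; apply: nS => D' del' del'0.
  apply: contrapT => h'; apply: h; exists D', del'; split=> // K K0 bK.
  by rewrite ltNge; apply/negP => Kle; apply: h'; exists K.
near=> n.
have Fn : F n != fset0 by exact: (proj1 FF).
have Fn0 : 0 < #|` F n|%:R :> R by rewrite ltr0n cardfs_gt0.
have bn : (boundary D (F n))%:R <= del * #|` F n|%:R.
  by near: n; apply: (left_folner_boundary _ FF).
have {}up : phi (F n) <= _ := up (F n) bn phi m M phiP (S_lb _ Sm) M0
  (fun K KL => proj1 (LT K KL)) (lexx _).
have {}lo : (inf S - e) * #|` F n|%:R < phi (F n).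
  by apply: lo => //; near: n; apply: (left_folner_boundary _ FF).
rewrite distrC ler_distl ler_pdivlMr // (ltW lo) /= ler_pdivrMr //.
rewrite (le_trans up) //.
rewrite ler_wpM2r //.
have : e / 2 / (m + M + 1) * (m + M + 1) = e / 2.
  by rewrite mulfVK // gt_eqF.
have := ltW d0.
by lra.
Unshelve. all: by end_near.
Qed.

End OrnsteinWeiss.

(** * Covering numbers of joins *)

Section LnNat.
Variable R : realType.

(** The convention [ln 0 = 0] makes the inequalities of this section hold at 0 too. *)
Lemma ln_nat_ge0 n : 0 <= ln n%:R :> R.
Proof. by case: n => [|n]; [rewrite ln0|rewrite ln_ge0 // ler1n]. Qed.

Lemma ler_ln_nat m n : (m <= n)%N -> ln m%:R <= ln n%:R :> R.
Proof.
case: m => [|m] mn; first by rewrite ln0 // ln_nat_ge0.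
by rewrite ler_ln ?posrE ?ltr0n ?ler_nat // (leq_trans _ mn).
Qed.

Lemma ln_natM m n : (0 < m)%N -> (0 < n)%N ->
  ln (m * n)%:R = ln m%:R + ln n%:R :> R.
Proof. by move=> m0 n0; rewrite natrM lnM ?posrE ?ltr0n. Qed.

Lemma ler_ln_natM m n : ln (m * n)%:R <= ln m%:R + ln n%:R :> R.
Proof.
case: m => [|m]; first by rewrite mul0n ln0 // add0r ln_nat_ge0.
case: n => [|n]; first by rewrite muln0 [ln 0]ln0 // addr0 ln_nat_ge0.
by rewrite ln_natM.
Qed.

End LnNat.

Lemma least_nat (P : nat -> Prop) : (exists n, P n) ->
  exists n, P n /\ forall m, P m -> (n <= m)%N.
Proof.
move=> [n0 Pn0]; have ex : exists n, `[< P n >] by exists n0; apply/asboolP.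
case: (ex_minnP ex) => n /asboolP Pn le_n; exists n; split=> // m Pm.
exact/le_n/asboolP.
Qed.

(** * Minimal subcovers, absolute and relative *)

Section Coverable.
Variable X : Type.
Implicit Types (C B : set (set X)) (S : set X).

(** Lists of at most [n] members make this monotone in [n], unlike the exact cardinality in
    [subcover_card]. *)
Definition coverable C S (n : nat) := exists s : seq (set X),
  [/\ (size s <= n)%N, forall A, A \in s -> C A
    & S `<=` \bigcup_(A in [set` s]) A].

Lemma coverableS C S S' n n' : S `<=` S' -> (n' <= n)%N ->
  coverable C S' n' -> coverable C S n.
Proof.
move=> SS' nn' [s [sn sC sS]]; exists s; split=> //; first exact: leq_trans nn'.
exact: subset_trans sS.
Qed.

(** A covering list without its repetitions has an exact cardinality, so the minimum chosen by [get]
    exists. *)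
Lemma cover_numberP C n : coverable C setT n ->
  coverable C setT (cover_number C) /\ (cover_number C <= n)%N.
Proof.
have to_coverable m : subcover_card C m -> coverable C setT m.
  move=> [V [VC Vm VT]]; have Vfin : finite_set V by apply/finite_setP; exists m.
  exists (fset_set V); split=> [|A|x _].
  - by rewrite (card_fset_set Vm).
  - by rewrite in_fset_set // inE; exact: VC.
  - have : setT x by [].
    by rewrite -{1}VT => -[A VA Ax]; exists A => //=; rewrite in_fset_set // inE.
have of_coverable m : coverable C setT m -> exists2 k, (k <= m)%N & subcover_card C k.
  move=> [s [sm sC sT]].
  exists (size (undup s)); first by rewrite (leq_trans (size_undup s)).
  exists [set` s]; split=> //.
  - rewrite -card_fseq.
    have -> : [set` s] = [set` [fset A in s]%fset].
      by apply/seteqP; split=> A /=; rewrite inE.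
    exact/card_eq_fsetP.
  - by apply/seteqP; split.
move=> Cn; have [k kn Ck] := of_coverable n Cn.
have [m [Cm le_m]] := least_nat (ex_intro _ k Ck).
have := getPex (ex_intro (fun n => subcover_card C n /\
  forall m, subcover_card C m -> (n <= m)%N) m (conj Cm le_m)).
rewrite -/(cover_number C) /= => -[? le_N]; split; first exact: to_coverable.
by rewrite (leq_trans (le_N _ Ck)).
Qed.

Definition coverable_all C B n := forall S, B S -> coverable C S n.

(* Junk if no [n] satisfies [coverable_all C B n]. *)
Definition relative_cover_number C B : nat :=
  get [set n | coverable_all C B n /\
               forall m, coverable_all C B m -> (n <= m)%N].

Lemma relative_cover_numberP C B n : coverable_all C B n ->
  coverable_all C B (relative_cover_number C B) /\
  (relative_cover_number C B <= n)%N.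
Proof.
move=> Cn; have [m Pm] := least_nat (ex_intro _ n Cn).
have := getPex (ex_intro (fun n => coverable_all C B n /\
  forall m, coverable_all C B m -> (n <= m)%N) m Pm).
by rewrite -/(relative_cover_number C B) /= => -[Cr /(_ _ Cn)].
Qed.

Lemma cover_number_relative C n : coverable C setT n ->
  cover_number C = relative_cover_number C [set setT].
Proof.
move=> Cn; have [CN leN] := cover_numberP Cn.
have CN' : coverable_all C [set setT] (cover_number C) by move=> S ->.
have [Cr ler] := relative_cover_numberP CN'.
apply/eqP; rewrite eqn_leq ler andbT.
by have [] := cover_numberP (Cr setT erefl).
Qed.

Lemma cover_number_mul C B n : coverable_all C B n ->
  coverable B setT (cover_number B) ->
  (cover_number C <= cover_number B * n)%N.
Proof.
move=> CBn [s [sB sub sT]].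
have /choice[f fP] : forall A, exists t : seq (set X), A \in s ->
    [/\ (size t <= n)%N, forall A, A \in t -> C A
    & A `<=` \bigcup_(A in [set` t]) A].
  move=> A; have [As|] := boolP (A \in s); last by exists [::].
  by have [t tP] := CBn A (sub A As); exists t.
have [] // := @cover_numberP C (cover_number B * n).
exists (flatten [seq f A | A <- s]); split=> [|A /flattenP[t /mapP[A' A's ->]]|x xT].
- rewrite size_flatten sumnE /shape -map_comp big_map.
  rewrite (leq_trans (n := \sum_(A <- s) n)) //.
    by rewrite big_seq [leqRHS]big_seq leq_sum // => A /fP[].
  by rewrite big_const_seq count_predT iter_addn_0 mulnC leq_mul.
- by have [_ /(_ A)] := fP _ A's.
- have [A /= As Ax] := sT x xT; have [_ _ /(_ x Ax)[A' /= A'f A'x]] := fP _ As.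
  exists A' => //=; apply/flattenP; exists (f A) => //.
  exact: map_f.
Qed.

Lemma cover_number_gt0 C n : [set: X] !=set0 ->
  coverable C setT n -> (0 < cover_number C)%N.
Proof.
move=> [x _] /cover_numberP[[[|A s] [sN _ sT]] _]; last exact: leq_trans sN.
by have [] := sT x I.
Qed.

End Coverable.

(** * Joins of translates of a cover *)

Section Join.
Variables (Gam : groupType) (X : Type) (a : Gam -> X -> X).
Hypothesis a1 : forall x, a 1%g x = x.
Hypothesis aM : forall s t x, a (s * t)%g x = a s (a t x).
Implicit Types (U V : set (set X)) (F : {fset Gam}) (S : set X).

Lemma cover_joinS U F F' S : (F `<=` F')%fset ->
  cover_join a U F' S -> exists2 S', cover_join a U F S' & S `<=` S'.
Proof.
move=> /fsubsetP FF' [c cU ->].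
exists (\bigcap_(s in [set` F]) (a s @^-1` c s)); first by exists c => // s /FF' /cU.
by move=> x h s sF; apply: h; apply: FF'.
Qed.

(** On the common part of [F] and [F'] only the choice [c] is kept, whence an inclusion. *)
Lemma cover_joinI U F F' S S' : cover_join a U F S -> cover_join a U F' S' ->
  exists2 S'', cover_join a U (F `|` F')%fset S'' & S `&` S' `<=` S''.
Proof.
move=> [c cU ->] [c' c'U ->].
pose c'' s := if s \in F then c s else c' s.
exists (\bigcap_(s in [set` (F `|` F')%fset]) (a s @^-1` c'' s)).
  exists c'' => // s; rewrite inE /c''.
  by case: ifP => [sF _|_ /= sF']; [apply: cU|apply: c'U].
move=> x [h h'] s /=; rewrite inE /c''; case: ifP => [sF _|_ /= sF'].
- exact: h.
- exact: h'.
Qed.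

(** Pulling back by [a s] moves a condition at time [f] to time [f * s]. *)
Lemma cover_join_translate U F s S : cover_join a U F S ->
  cover_join a U (translate F s) (a s @^-1` S).
Proof.
move=> [c cU ->]; exists (fun t => c (t * s^-1)%g) => [t|].
  by rewrite translateE => /cU.
apply/seteqP; split=> x /= h t /= tF.
- by move: (h _ (eq_ind _ is_true tF _ (translateE F s t))); rewrite /= -aM mulgVK.
- rewrite -aM -[t in c t](mulgK s); apply: h.
  by rewrite /= translateE mulgK.
Qed.

Lemma coverable_join U F F' S S' n n' :
  coverable (cover_join a U F) S n -> coverable (cover_join a U F') S' n' ->
  coverable (cover_join a U (F `|` F')%fset) (S `&` S') (n * n').
Proof.
move=> [s [sn sU sS]] [s' [sn' sU' sS']].
have /choice[f fP] : forall p : set X * set X, exists A : set X,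
    p.1 \in s -> p.2 \in s' ->
    cover_join a U (F `|` F')%fset A /\ p.1 `&` p.2 `<=` A.
  move=> [A A'] /=; have [As|] := boolP (A \in s); last by exists setT.
  have [A's|] := boolP (A' \in s'); last by exists setT.
  by have [A'' ? ?] := cover_joinI (sU _ As) (sU' _ A's); exists A''.
exists [seq f (A, A') | A <- s, A' <- s']; split=> [|B /allpairsP|x [Sx S'x]].
- by rewrite size_allpairs leq_mul.
- by move=> [[A A'] /= [As A's ->]]; have [] := fP (A, A') As A's.
- have [A /= As Ax] := sS x Sx; have [A' /= As' A'x] := sS' x S'x.
  exists (f (A, A')); first exact: allpairs_f.
  by have [_] := fP (A, A') As As'; apply.
Qed.

Lemma coverable_translate U F S n s :
  coverable (cover_join a U F) S n ->
  coverable (cover_join a U (translate F s)) (a s @^-1` S) n.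
Proof.
move=> [t [tn tU tS]]; exists [seq a s @^-1` A | A <- t]; split.
- by rewrite size_map.
- by move=> A /mapP[B /tU BU ->]; exact: cover_join_translate.
- move=> x /tS[A /= At Ax]; exists (a s @^-1` A) => //=.
  exact: (map_f (fun A => a s @^-1` A)).
Qed.

Lemma coverable_join0 U S : coverable (cover_join a U fset0) S 1.
Proof.
exists [:: setT]; split=> // [A|x _]; last by exists setT => //=; rewrite inE.
rewrite inE => /eqP ->; exists (fun=> setT) => //.
by apply/seteqP; split.
Qed.

Lemma coverable_join1 U s n : coverable U setT n ->
  coverable (cover_join a U [fset s]%fset) setT n.
Proof.
move=> [t [tn tU tT]]; exists [seq a s @^-1` A | A <- t]; split.
- by rewrite size_map.
- move=> A /mapP[B /tU BU ->]; exists (fun=> B) => //.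
  apply/seteqP; split=> x /= h; last by apply: h; rewrite /= inE.
  by move=> t'; rewrite /= inE => /eqP ->.
- move=> x _; have [A /= At Ax] := tT (a s x) I; exists (a s @^-1` A) => //=.
  exact: (map_f (fun A => a s @^-1` A)).
Qed.

Lemma coverable_join_finite U F n : coverable U setT n ->
  exists m, coverable (cover_join a U F) setT m.
Proof.
move=> Un; elim/fset1U_rect: F => [|s F _ [m IH]].
  by exists 1%N; exact: coverable_join0.
by exists (n * m)%N; rewrite -(setIT setT); exact/coverable_join/IH/coverable_join1.
Qed.

(** The psi(F) of the overview: the conditional covering number of [U^F] given [V^F]. *)
Definition join_number U V F : nat :=
  relative_cover_number (cover_join a U F) (cover_join a V F).

Lemma join_numberP U V F n : coverable U setT n ->
  coverable_all (cover_join a U F) (cover_join a V F) (join_number U V F).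
Proof.
move=> Un; have [m Um] := coverable_join_finite F Un.
have : coverable_all (cover_join a U F) (cover_join a V F) m.
  by move=> S _; exact: coverableS Um.
by case/relative_cover_numberP.
Qed.

Lemma join_number_le U V F n :
  coverable_all (cover_join a U F) (cover_join a V F) n ->
  (join_number U V F <= n)%N.
Proof. by case/relative_cover_numberP. Qed.

(** A member of the join of [V] over a union lies in one member for each part, and intersecting the
    covers of these multiplies their sizes. For a translate, one moves back to [F] by [s^-1], covers
    there and returns. *)
Lemma join_number_subadditive (R : realType) U V n : coverable U setT n ->
  subadditive_invariant (fun F => ln (join_number U V F)%:R : R).
Proof.
move=> Un; split=> [|F F'|F s].
- suff : (join_number U V fset0 <= 1)%N by move=> /(ler_ln_nat R); rewrite ln1.
  by apply: join_number_le => S _; exact: coverable_join0.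
- rewrite (le_trans _ (ler_ln_natM _ _ _)) // ler_ln_nat //.
  apply: join_number_le => S VS.
  have [S1 VS1 SS1] := cover_joinS (fsubsetUl _ _) VS.
  have [S2 VS2 SS2] := cover_joinS (fsubsetUr _ _) VS.
  have SS12 : S `<=` S1 `&` S2 by move=> x Sx; split; [apply: SS1|apply: SS2].
  apply: (coverableS SS12 (leqnn _)).
  by apply: coverable_join; apply: (join_numberP Un).
- rewrite ler_ln_nat // join_number_le // => S VS.
  have /(cover_join_translate s^-1) : cover_join a V (translate F s) S by [].
  have -> : translate (translate F s) s^-1 = F.
    by apply/fsetP => x; rewrite !translateE invgK mulgK.
  move=> /(join_numberP Un)/(coverable_translate s).
  by congr coverable; apply/seteqP; split=> x; rewrite /= -aM mulVg a1.
Qed.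

(** The trivial cover makes the absolute number a relative one, so a single convergence result
    serves both. *)
Lemma cover_number_join U F n : coverable U setT n ->
  cover_number (cover_join a U F) = join_number U [set setT] F.
Proof.
move=> Un; have [m Um] := coverable_join_finite F Un.
rewrite (cover_number_relative Um); congr relative_cover_number.
apply/seteqP; split=> [S ->|S [c cT ->]].
  by exists (fun=> setT) => //; apply/seteqP; split.
by apply/seteqP; split=> // x _ s /cT /= ->.
Qed.

End Join.

(** * Compact metric spaces *)

Section CompactMetric.
Variable R : realType.

Definition compatible_metric (X : topologicalType) (d : X -> X -> R) :=
  [/\ forall x y, d x y = 0 <-> x = y,
      forall x y, d x y = d y x,
      forall x y z, d x z <= d x y + d y z
    & forall x (A : set X),
        nbhs x A <-> exists2 e : R, 0 < e & [set y | d x y < e] `<=` A].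

Section Metric.
Variables (X : topologicalType) (d : X -> X -> R).
Hypothesis dP : compatible_metric d.

Lemma metricxx x : d x x = 0. Proof. by case: dP => d0 _ _ _; apply/d0. Qed.

Lemma metricC x y : d x y = d y x. Proof. by case: dP. Qed.

Lemma metric_triangle x y z : d x z <= d x y + d y z. Proof. by case: dP. Qed.

Lemma metric_ge0 x y : 0 <= d x y.
Proof. by have := metric_triangle x y x; rewrite metricxx (metricC y x); lra. Qed.

Lemma metric_gt0 x y : x <> y -> 0 < d x y.
Proof.
move=> xy; rewrite lt_neqAle metric_ge0 andbT eq_sym; apply/eqP => d0; apply: xy.
by case: dP => dE _ _ _; apply/dE.
Qed.

Lemma nbhs_metricP x (A : set X) :
  nbhs x A <-> exists2 e : R, 0 < e & [set y | d x y < e] `<=` A.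
Proof. by case: dP. Qed.

Lemma nbhs_metric_ball x e : 0 < e -> nbhs x [set y | d x y < e].
Proof. by move=> e0; apply/nbhs_metricP; exists e. Qed.

Lemma open_metric_ball x e : open [set y | d x y < e].
Proof.
rewrite openE => y /= xy; apply/nbhs_metricP; exists (e - d x y) => [|z /= yz].
  by rewrite subr_gt0.
by have := metric_triangle x y z; lra.
Qed.

Lemma continuous_metric : continuous (fun z : X * X => d z.1 z.2).
Proof.
move=> [x y]; apply/cvgrPdist_lt => e e0 /=.
have e20 : 0 < e / 2 by rewrite divr_gt0.
exists ([set x' | d x x' < e / 2], [set y' | d y y' < e / 2]).
  by split; exact: nbhs_metric_ball.
move=> [x' y'] [/= xx' yy'].
have := metric_triangle x x' y; have := metric_triangle x' y' y.
have := metric_triangle x' x y'; have := metric_triangle x y y'.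
rewrite (metricC x' x) (metricC y' y) ltr_distl; lra.
Qed.

End Metric.

(** Where [f > 0], the premise fails nearby for small [e]; elsewhere [h < del] persists nearby.
    Compactness makes [e] uniform. The uniform estimates on [m] and [p] are instances. *)
Lemma compact_uniform (X : topologicalType) (f h : X -> R) (del : R) :
  compact [set: X] -> continuous f -> continuous h ->
  (forall x, f x <= 0 -> h x < del) ->
  exists2 e, 0 < e & forall x, f x < e -> h x < del.
Proof.
move=> /compact_near_coveringP cX cf ch fh.
have cov : \forall e \near 0^'+, [set: X] `<=` (fun x => f x < e -> h x < del).
  apply: cX => x _; have [f0|f0] := leP (f x) 0.
    exists ([set x' | h x' < del], setT) => /=; last by move=> [x' e] [].
    split; last exact: filterT.
    by apply: (cvgr_lt _ (ch x)); exact: fh.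
  exists ([set x' | f x / 2 < f x'], [set e | e < f x / 2]) => /=.
    split; last by apply: nbhs_right_lt; rewrite divr_gt0.
    by apply: (cvgr_gt _ (cf x)); rewrite ltr_pdivrMr // ltr_pMr // ltr1n.
  by move=> [x' e] [/= h1 h2 h3]; lra.
near ((0 : R)^'+) => e; exists e; first by near: e; exact: nbhs_right_gt.
suff : [set: X] `<=` (fun x => f x < e -> h x < del) by move=> cove x; exact: cove.
by near: e.
Unshelve. all: by end_near.
Qed.

(** Serves for covers by small sets and for covers of the base adapted to finitely many tiles. *)
Lemma compact_open_refinement (X : topologicalType) (P : set X -> Prop) :
  compact [set: X] -> (forall x, exists O, [/\ open O, O x & P O]) ->
  exists2 V, finite_open_cover V & forall A, V A -> P A.
Proof.
move=> /compact_near_coveringP cX /choice[nb nbP].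
(* The filter of all sufficiently large finite sets of centres. *)
pose Fil : set_system (seq X) :=
  [set A : set (seq X) | exists s0 : seq X,
     forall s : seq X, {subset s0 <= s} -> A s].
have FilF : Filter Fil.
  split; first by exists [::].
    move=> A B [s sA] [t tB]; exists (s ++ t) => u stu.
    by split; [apply: sA|apply: tB] => x xs; apply: stu; rewrite mem_cat xs ?orbT.
  by move=> A B AB [s sA]; exists s => t /sA/AB.
have [s /(_ s (fun _ => id)) sT] :
    Fil (fun s => [set: X] `<=` [set x | exists2 y, y \in s & nb y x]).
  apply: (@cX _ Fil (fun s x => exists2 y, y \in s & nb y x)) => x _.
  exists (nb x, [set s : seq X | x \in s]) => /=.
    split; last by exists [:: x] => s; apply; rewrite mem_head.
    by have [oO Ox _] := nbP x; exact: open_nbhs_nbhs.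
  by move=> [x' s] [/= Ox' xs]; exists x.
exists (nb @` [set` s]); last by move=> _ [x _ <-]; have [] := nbP x.
split.
- exact/finite_image/finite_seq.
- by move=> _ [x _ <-]; have [] := nbP x.
- apply/seteqP; split=> // x _; have [//|y ys yx] := sT x.
  by exists (nb y) => //; exists y.
Qed.

Section CompactSpace.
Variables (X : topologicalType) (d : X -> X -> R).
Hypotheses (dP : compatible_metric d) (cX : compact [set: X]).

Lemma lebesgue_number U : finite_open_cover U ->
  exists2 e : R, 0 < e &
    forall x, exists2 A, U A & forall y, d x y < e -> A y.
Proof.
move=> [_ oU UT].
pose P e x := exists2 A, U A & forall y, d x y < e -> A y.
have cov : \forall e \near 0^'+, [set: X] `<=` P e.
  apply: (compact_near_coveringP _).1 => // x _; have : [set: X] x by [].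
  rewrite -{1}UT => -[A UA Ax].
  have : nbhs x A by apply: open_nbhs_nbhs; split=> //; exact: oU.
  move=> /(nbhs_metricP dP)[e e0 eA].
  have e20 : 0 < e / 2 by rewrite divr_gt0.
  exists ([set y | d x y < e / 2], [set e' | e' < e / 2]) => /=.
    by split; [exact: nbhs_metric_ball|exact: nbhs_right_lt].
  move=> [x' e'] [/= xx' e'e]; exists A => // y x'y; apply: eA => /=.
  by have := metric_triangle dP x x' y; lra.
near ((0 : R)^'+) => e; exists e; first by near: e; exact: nbhs_right_gt.
suff : [set: X] `<=` P e by move=> cove x; exact: cove.
by near: e.
Unshelve. all: by end_near.
Qed.

Lemma small_cover (e : R) : 0 < e ->
  exists2 V, finite_open_cover V &
    forall A, V A -> forall x y, A x -> A y -> d x y < e.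
Proof.
move=> e0; apply: compact_open_refinement => // x.
exists [set y | d x y < e / 2]; split.
- exact: open_metric_ball.
- by rewrite /= (metricxx dP) divr_gt0.
- move=> y z /= xy xz; have := metric_triangle dP y x z.
  by rewrite (metricC dP y x); lra.
Qed.

End CompactSpace.

(** If [p x] differs from [y], then [p x' = y'] is impossible for [x'] near [x] and [y'] near [y];
    on the fibre, [O] itself is a neighbourhood. *)
Lemma compact_tube (X Y : topologicalType) (d : Y -> Y -> R) (p : X -> Y)
    (O : set X) y :
  compatible_metric d -> compact [set: X] -> continuous p -> open O ->
  p @^-1` [set y] `<=` O ->
  exists O', [/\ open O', O' y & p @^-1` O' `<=` O].
Proof.
move=> dP cX cp oO pO.
have Ny : \forall y' \near y, [set: X] `<=` (fun x => p x = y' -> O x).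
  apply: (compact_near_coveringP _).1 => // x _; have [pxy|pxy] := pselect (p x = y).
    exists (O, setT) => /=; last by move=> [x' y'] [].
    split; last exact: filterT.
    by apply: open_nbhs_nbhs; split=> //; exact: pO.
  have e0 := metric_gt0 dP pxy.
  have e20 : 0 < d (p x) y / 2 by rewrite divr_gt0.
  exists (p @^-1` [set z | d (p x) z < d (p x) y / 2],
          [set z | d y z < d (p x) y / 2]) => /=.
    by split; [apply: cp|]; exact: nbhs_metric_ball.
  move=> [x' y'] [/= xx' yy'] px'; have := metric_triangle dP (p x) y' y.
  by rewrite (metricC dP y' y) -px'; move: xx' yy'; rewrite -px'; lra.
move: Ny; rewrite /prop_near1 nbhsE => -[M [oM My] MN].
by exists M; split=> // x /= /MN/(_ x I); apply.
Qed.

End CompactMetric.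

(** * Separated families, entropy and extensions *)

Section Separated.
Variables (Gam : groupType) (X : Type) (a : Gam -> X -> X).
Implicit Types (U Z : set (set X)) (D : X -> X -> Prop) (F : {fset Gam}).

(** Bowen's separated sets, with a relation [D] in place of a distance below some bound. *)
Definition separated D F (I : Type) (e : I -> X) :=
  forall i j, i <> j -> exists2 s, s \in F & ~ D (a s (e i)) (a s (e j)).

(** Greedy choice: fewer than [N] members of [U^F], one attached to each chosen point, cannot cover
    the space, and a point outside them is separated from all chosen ones. *)
Lemma separated_exists U D F n : [set: X] !=set0 ->
  (forall x y, D x y -> D y x) ->
  (forall x, exists2 A, U A & forall y, D x y -> A y) ->
  coverable (cover_join a U F) setT n ->
  exists e : 'I_(cover_number (cover_join a U F)) -> X, separated D F e.
Proof.
move=> [x0 _] Dsym UD Un.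
have /choice[c cP] : forall x, exists A, U A /\ forall y, D x y -> A y.
  by move=> x; have [A UA AP] := UD x; exists A.
set N := cover_number _.
have cU x : U (c x) by have [] := cP x.
(* Contains every point that stays close to [x] at all times in [F]. *)
pose f x := \bigcap_(s in [set` F]) (a s @^-1` c (a s x)).
have fU x : cover_join a U F (f x) by exists (fun s => c (a s x)).
have fD x y : ~ f x y -> exists2 s, s \in F & ~ D (a s x) (a s y).
  move=> nf; apply: contrapT => nD; apply: nf => s sF.
  have [_] := cP (a s x); apply; apply: contrapT => nDs; apply: nD.
  by exists s.
have [e eP] : exists e : nat -> X, forall i j, (i < j < N)%N ->
    exists2 s, s \in F & ~ D (a s (e i)) (a s (e j)).
  suff grow k : (k <= N)%N -> exists e : nat -> X, forall i j, (i < j < k)%N ->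
    exists2 s, s \in F & ~ D (a s (e i)) (a s (e j)) by exact: (grow N).
  elim: k => [|k IHk] kN; first by exists (fun=> x0) => i j; rewrite andbF.
  have [e eP] := IHk (ltnW kN).
  have [y ny] : exists y, forall i, (i < k)%N -> ~ f (e i) y.
    apply: contrapT => ny; suff : (N <= k)%N by rewrite leqNgt kN.
    have [] // := @cover_numberP _ (cover_join a U F) k.
    exists [seq f (e i) | i <- iota 0 k]; split.
    - by rewrite size_map size_iota.
    - by move=> A /mapP[i _ ->].
    - move=> y _; apply: contrapT => ncov; apply: ny; exists y => i ik fy.
      apply: ncov; exists (f (e i)) => //=.
      by apply: (map_f (fun i => f (e i))); rewrite mem_iota add0n.
  exists (fun i => if (i < k)%N then e i else y) => i j /andP[ij].
  rewrite ltnS leq_eqVlt => /predU1P[jk|jk].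
    by rewrite jk ltnn -jk ij; apply: fD; apply: ny; rewrite -jk.
  by rewrite jk (ltn_trans ij jk); apply: eP; rewrite ij.
exists (fun i : 'I_N => e i) => i j ij.
have [lt_ij|lt_ji|/val_inj //] := ltngtP i j.
  by apply: eP; rewrite lt_ij ltn_ord.
have [|s sF nD] := eP j i; first by rewrite lt_ji ltn_ord.
by exists s => // /Dsym.
Qed.

(** Points of one member of [Z^F] stay close at all times in [F], so separated points need distinct
    members. *)
Lemma card_separated Z D F (I : finType) (e : I -> X) n :
  coverable (cover_join a Z F) setT n ->
  (forall A, Z A -> forall x y, A x -> A y -> D x y) ->
  separated D F e -> (#|I| <= n)%N.
Proof.
move=> [s [sn sZ sT]] ZD sep; rewrite (leq_trans _ sn) //.
have /choice[f fP] : forall i, exists A, A \in s /\ A (e i).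
  by move=> i; have [A As Aei] := sT (e i) Logic.I; exists A.
have idx i : (index (f i) s < size s)%N by rewrite index_mem; have [] := fP i.
rewrite -[size s]card_ord; apply: (@leq_card _ _ (fun i => Ordinal (idx i))).
move=> i j [/(congr1 (nth setT s))]; have [fs fi] := fP i; have [fs' fj] := fP j.
rewrite !nth_index // => fij; apply: contrapT => /sep[t tF]; apply.
have [c cZ fE] := sZ _ fs.
apply: (ZD (c t)); first exact: cZ.
  by move: fi; rewrite fE; apply.
by move: fj; rewrite -fij fE; apply.
Qed.

End Separated.

(** * Existence of the limit defining the entropy of a cover *)

Section Entropy.
Variables (R : realType) (Gam : groupType).
Hypothesis amen : amenable R Gam.

Lemma finite_open_cover_coverable (X : topologicalType) (U : set (set X)) :
  finite_open_cover U -> exists n, coverable U setT n.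
Proof.
move=> [/finite_seqP[s sE] _ UT]; exists (size s), s; split=> // [A|].
  by rewrite sE.
by rewrite -sE UT.
Qed.

Lemma htop_coverP (X : topologicalType) (a : Gam -> X -> X) (U : set (set X))
    (F : nat -> {fset Gam}) :
  continuous_action a -> finite_open_cover U -> left_folner R F ->
  (fun n => ln (cover_number (cover_join a U (F n)))%:R / #|` F n|%:R) @ \oo
    --> htop_cover R a U.
Proof.
move=> [a1 aM _] /finite_open_cover_coverable[n Un] FF.
suff ex : exists l : R, forall F : nat -> {fset Gam}, left_folner R F ->
    (fun n => ln (cover_number (cover_join a U (F n)))%:R / #|` F n|%:R)
      @ \oo --> l by exact: (getPex ex).
have [l lP] := ornstein_weiss amen
  (join_number_subadditive a1 aM R [set setT] Un) (fun=> ln_nat_ge0 R _).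
exists l => F' FF'; under eq_fun => k do rewrite (cover_number_join _ _ Un).
exact: lP.
Qed.

Lemma htop_cover_ge0 (X : topologicalType) (a : Gam -> X -> X) U :
  continuous_action a -> finite_open_cover U -> 0 <= htop_cover R a U.
Proof.
move=> aP UP; have [F FF] := amen.
apply: (cvgr_to_ge (htop_coverP aP UP FF)); near=> n.
by rewrite divr_ge0 ?ln_nat_ge0.
Unshelve. all: by end_near.
Qed.

End Entropy.

(** * Extensions: comparison of covering numbers *)

Section Extension.
Variables (R : realType) (Gam : groupType) (X Y G : topologicalType).
Variables (aX : Gam -> X -> X) (aY : Gam -> Y -> Y) (aG : Gam -> G -> G).
Variables (p : X -> Y) (m : X -> G -> X).
Variables (dX : X -> X -> R) (dY : Y -> Y -> R) (dG : G -> G -> R).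
Hypotheses (dXP : compatible_metric dX) (dYP : compatible_metric dY)
  (dGP : compatible_metric dG).
Hypotheses (cX : compact [set: X]) (cY : compact [set: Y])
  (cG : compact [set: G]).
Hypotheses (aXP : continuous_action aX) (aYP : continuous_action aY)
  (aGP : continuous_action aG).
Hypothesis factor : factor_map aX aY p.
Hypothesis m_continuous : continuous (fun z : X * G => m z.1 z.2).
Hypothesis m_range : forall x, p @^-1` [set p x] = range (m x).
Hypothesis m_inj : forall x g g', m x g = m x g' -> g = g'.
Hypothesis m_act : forall s x g, aX s (m x g) = m (aX s x) (aG s g).

Lemma p_m x g : p (m x g) = p x.
Proof.
have : range (m x) (m x g) by exists g.
by rewrite -m_range.
Qed.

(** Triples (x, g, g') encode pairs of points of one fibre. *)
Let cXGG : compact [set: X * G * G].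
Proof.
by rewrite -setXTT; apply: compact_setX => //; rewrite -setXTT; apply: compact_setX.
Qed.

Let continuous_dG : continuous (fun z : X * G * G => dG z.1.2 z.2).
Proof.
move=> z; apply: (@continuous2_cvg _ _ _ _ _ _
  (fun z : X * G * G => z.1.2) snd (fun g g' => dG g g')).
- exact: continuous_metric.
- exact: (@continuous_comp _ _ _ fst snd z cvg_fst cvg_snd).
- exact: cvg_snd.
Qed.

Let continuous_dXm :
  continuous (fun z : X * G * G => dX (m z.1.1 z.1.2) (m z.1.1 z.2)).
Proof.
move=> z; apply: (@continuous2_cvg _ _ _ _ _ _
  (fun z : X * G * G => m z.1.1 z.1.2) (fun z => m z.1.1 z.2) dX).
- exact: continuous_metric.
- apply: (@continuous_comp (X * G * G)%type (X * G)%type X fst (fun z => m z.1 z.2) z).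
    exact: cvg_fst.
  exact: m_continuous.
- apply: (@continuous2_cvg _ _ _ _ _ _ (fun z : X * G * G => z.1.1) snd m).
  + exact: (@m_continuous (z.1.1, z.2)).
  + exact: (@continuous_comp _ _ _ fst fst z cvg_fst cvg_fst).
  + exact: cvg_snd.
Qed.

(** Injectivity of g -> xg, made uniform in [x] by compactness. *)
Lemma fiber_separation del : 0 < del ->
  exists2 e, 0 < e & forall x g g', dX (m x g) (m x g') < e -> dG g g' < del.
Proof.
move=> del0.
have [] := compact_uniform cXGG continuous_dXm continuous_dG (del := del).
  move=> [[x g] g'] /= d0; suff -> : g = g' by rewrite (metricxx dGP).
  apply: contrapT => gg'; have : m x g <> m x g' by move=> /m_inj.
  by move=> /(metric_gt0 dXP); lra.
by move=> e e0 eP; exists e => // x g g'; exact: (eP (x, g, g')).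
Qed.

Lemma fiber_contraction del : 0 < del ->
  exists2 e, 0 < e & forall x g g', dG g g' < e -> dX (m x g) (m x g') < del.
Proof.
move=> del0.
have [] := compact_uniform cXGG continuous_dG continuous_dXm (del := del).
  move=> [[x g] g'] /= d0; suff -> : g = g' by rewrite (metricxx dXP).
  by apply: contrapT => /(metric_gt0 dGP); lra.
by move=> e e0 eP; exists e => // x g g'; exact: (eP (x, g, g')).
Qed.

Lemma base_separation del : 0 < del ->
  exists2 e, 0 < e & forall x x', dX x x' < e -> dY (p x) (p x') < del.
Proof.
have [cp _ _] := factor; move=> del0.
have cXX : compact [set: X * X] by rewrite -setXTT; exact: compact_setX.
have cdY : continuous (fun z : X * X => dY (p z.1) (p z.2)).
  move=> z; apply: (@continuous2_cvg _ _ _ _ _ _ (p \o fst) (p \o snd) dY).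
  - exact: continuous_metric.
  - exact: (@continuous_comp _ _ _ fst p z cvg_fst (cp _)).
  - exact: (@continuous_comp _ _ _ snd p z cvg_snd (cp _)).
have [] := compact_uniform cXX (continuous_metric dXP) cdY (del := del).
  move=> [x x'] /= d0; suff -> : x = x' by rewrite (metricxx dYP).
  by apply: contrapT => /(metric_gt0 dXP); lra.
by move=> e e0 eP; exists e => // x x'; exact: (eP (x, x')).
Qed.

(* Separated points of [Y], lifted to [X] and translated by separated elements
   of [G], form a separated family of [X]. *)
Lemma cover_number_mul_extension U W : [set: Y] !=set0 -> [set: G] !=set0 ->
  finite_open_cover U -> finite_open_cover W ->
  exists2 Z, finite_open_cover Z & forall F,
    (cover_number (cover_join aY U F) * cover_number (cover_join aG W F) <=
     cover_number (cover_join aX Z F))%N.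
Proof.
move=> Y0 G0 UP WP.
have [eU eU0 eUP] := lebesgue_number dYP cY UP.
have [eW eW0 eWP] := lebesgue_number dGP cG WP.
have [e1 e10 e1P] := base_separation eU0.
have [e2 e20 e2P] := fiber_separation eW0.
have e0 : 0 < Num.min e1 e2 by rewrite lt_min e10.
have [Z ZP Zsmall] := small_cover dXP cX e0.
exists Z => // F.
have [nU /(coverable_join_finite aY F)[nU' Un]] := finite_open_cover_coverable UP.
have [nW /(coverable_join_finite aG F)[nW' Wn]] := finite_open_cover_coverable WP.
have [nZ /(coverable_join_finite aX F)[nZ' Zn]] := finite_open_cover_coverable ZP.
have symY y y' : dY y y' < eU -> dY y' y < eU by rewrite (metricC dYP).
have symG g g' : dG g g' < eW -> dG g' g < eW by rewrite (metricC dGP).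
have [u usep] := separated_exists Y0 symY eUP Un.
have [w wsep] := separated_exists G0 symG eWP Wn.
have [_ p_surj p_act] := factor.
have [lift liftP] := choice p_surj.
rewrite -[X in (X * _)%N]card_ord -[X in (_ * X)%N]card_ord -card_prod.
apply: (card_separated (a := aX) (F := F)
  (D := fun x x' => dX x x' < Num.min e1 e2)
  (e := fun ij => m (lift (u ij.1)) (w ij.2)) _ Zsmall).
  by have [] := cover_numberP Zn.
move=> [i j] [i' j'] /= neq.
(* Over one base point, the elements of [G] are told apart along the fibre; otherwise the
   projections to [Y] are. *)
have [ii'|ii'] := pselect (i = i').
  have jj' : j <> j' by move=> jj'; apply: neq; rewrite ii' jj'.
  have [s sF nw] := wsep _ _ jj'; exists s => //.
  rewrite -ii' !m_act lt_min => /andP[_ /e2P]; exact: nw.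
have [s sF nu] := usep _ _ ii'; exists s => //.
rewrite lt_min => /andP[/e1P + _]; rewrite !p_act !p_m !liftP; exact: nu.
Qed.

(** [fiber_contraction] is uniform in [x], so one [W] serves all fibres: each xB lies in a Lebesgue
    ball of [U]. *)
Lemma fiber_cover U : [set: X] !=set0 -> finite_open_cover U ->
  exists2 W, finite_open_cover W & forall x B, W B ->
    exists2 A, U A & forall g, B g -> A (m x g).
Proof.
move=> [x0 _] UP.
have [e e0 eP] := lebesgue_number dXP cX UP.
have [e1 e10 e1P] := fiber_contraction e0.
have [W WP Wsmall] := small_cover dGP cG e10.
exists W => // x B WB; have [[g Bg]|B0] := pselect (exists g, B g).
  have [A UA AP] := eP (m x g); exists A => // g' Bg'.
  exact/AP/e1P/(Wsmall B).
have [A UA _] := eP x; exists A => // g Bg.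
by case: B0; exists g.
Qed.

(** * From covers of the fibres to a cover of the base *)

Section Fiber.
Variables (U : set (set X)) (W : set (set G)).
Hypothesis U_open : forall A, U A -> open A.
Hypothesis fiberUW : forall x B, W B ->
  exists2 A, U A & forall g, B g -> A (m x g).

(** As s(xg) = (sx)(sg), the condition at time [s] is met by applying [fiberUW] at the point sx. *)
Lemma coverable_fiber K x n : coverable (cover_join aG W K) setT n ->
  coverable (cover_join aX U K) (p @^-1` [set p x]) n.
Proof.
rewrite m_range => -[t [tn tW tT]].
have /choice[f fP] : forall B, exists A, B \in t ->
    cover_join aX U K A /\ forall g, B g -> A (m x g).
  move=> B; have [Bt|] := boolP (B \in t); last by exists setT.
  have [c cW ->] := tW B Bt.
  have /choice[c' c'P] : forall s, exists A, s \in K ->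
      U A /\ forall g, c s g -> A (m (aX s x) g).
    move=> s; have [sK|] := boolP (s \in K); last by exists setT.
    by have [A UA AP] := fiberUW (aX s x) (cW s sK); exists A.
  exists (\bigcap_(s in [set` K]) (aX s @^-1` c' s)) => _; split.
    by exists c' => // s /c'P[].
  by move=> g gc s sK /=; rewrite m_act; have [_] := c'P s sK; apply; exact: gc.
exists [seq f B | B <- t]; split.
- by rewrite size_map.
- by move=> A /mapP[B /fP[]] ? _ ->.
- move=> _ [g _ <-]; have [B /= Bt Bg] := tT g Logic.I.
  by exists (f B) => /=; [exact: map_f|have [_] := fP B Bt; apply].
Qed.

Lemma open_cover_join K A : cover_join aX U K A -> open A.
Proof.
have [_ _ aXc] := aXP.
move=> [c cU ->]; rewrite openE => x xc; apply: filter_bigI => s sK.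
apply: open_nbhs_nbhs; split; last exact: xc.
by apply: open_comp => [y _|]; [exact: aXc|exact/U_open/cU].
Qed.

(** Members of [U^K] are open, so those covering a fibre cover a tube around it. *)
Lemma coverable_fiber_nbhs K y n : coverable (cover_join aG W K) setT n ->
  exists O, [/\ open O, O y & coverable (cover_join aX U K) (p @^-1` O) n].
Proof.
have [cp p_surj _] := factor; have [x <-] := p_surj y.
move=> /(coverable_fiber x)[s [sn sU sx]].
have oS : open (\bigcup_(A in [set` s]) A).
  by apply: bigcup_open => A /sU; exact: open_cover_join.
have [M [oM My pM]] := compact_tube dYP cX cp oS sx.
by exists M; split=> //; exists s.
Qed.

Definition pullback (V : set (set Y)) : set (set X) := [set p @^-1` B | B in V].

Lemma coverable_pullback V F n : coverable (cover_join aY V F) setT n ->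
  coverable (cover_join aX (pullback V) F) setT n.
Proof.
have [_ _ p_act] := factor.
move=> [s [sn sV sT]]; exists [seq p @^-1` B | B <- s]; split.
- by rewrite size_map.
- move=> A /mapP[B /sV[c cV ->] ->]; exists (fun s => p @^-1` c s).
    by move=> t /cV; exists (c t).
  by apply/seteqP; split=> x /= h t tF; have := h t tF; rewrite /= p_act.
- move=> x _; have [B /= Bs Bx] := sT (p x) Logic.I; exists (p @^-1` B) => //=.
  exact: (map_f (fun B => p @^-1` B)).
Qed.

(** A member of [V^K] is controlled through its condition at the single time [pt K]. Finitely many
    tiles are handled by intersecting neighbourhoods. *)
Lemma exists_base_cover (L : seq {fset Gam}) (n : {fset Gam} -> nat) :
  (forall K, K \in L -> K != fset0) ->
  (forall K, K \in L -> coverable (cover_join aG W K) setT (n K)) ->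
  exists2 V, finite_open_cover V & forall K, K \in L ->
    (join_number aX U (pullback V) K <= n K)%N.
Proof.
move=> L0 LW; have [aY1 aYM aYc] := aYP; have [_ _ p_act] := factor.
have /choice[pt ptK] : forall K, exists s, K \in L -> s \in K.
  move=> K; have [/L0/fset0Pn[s sK]|] := boolP (K \in L); last by exists 1%g.
  by exists s.
pose good O K :=
  coverable (cover_join aX U K) (p @^-1` (aY (pt K) @^-1` O)) (n K).
have [y|V VP Vgood] := compact_open_refinement
    (P := fun O => forall K, K \in L -> good O K) cY.
  elim: L L0 LW {ptK} => [|K L IHL] L0 LW; first by exists setT; split=> //; exact: openT.
  have [N [oN Ny NL]] : exists O, [/\ open O, O y & forall K, K \in L -> good O K].
    by apply: IHL => K' K'L; [apply: L0|apply: LW]; rewrite inE K'L orbT.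
  have [M [oM My MK]] := coverable_fiber_nbhs (aY (pt K)^-1%g y) (LW K (mem_head _ _)).
  (* The preimage of this set under [aY (pt K)] lies in [M]. *)
  exists (N `&` aY (pt K)^-1%g @^-1` M); split.
  - by apply: openI => //; apply: open_comp => // z _; exact: aYc.
  - by split.
  - move=> K'; rewrite inE => /predU1P[->|/NL tO].
      apply: coverableS MK => // x [_] /=.
      by rewrite -aYM mulVg aY1.
    by apply: coverableS tO => // x [].
exists V => // K KL; apply: join_number_le => _ [c cV ->].
have [B VB BE] := cV _ (ptK K KL).
apply: coverableS (Vgood B VB K KL) => // x /(_ _ (ptK K KL)) /=.
by rewrite -BE /= p_act.
Qed.

End Fiber.

(** * Inequalities between entropies of covers *)

Lemma htop_cover_extension_le U : [set: X] !=set0 -> amenable R Gam ->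
  finite_open_cover U ->
  exists2 W, finite_open_cover W & forall eps, 0 < eps ->
    exists2 V, finite_open_cover V &
      htop_cover R aX U <= htop_cover R aY V + (htop_cover R aG W + eps).
Proof.
move=> X0 amen UP; have [W WP fiberUW] := fiber_cover X0 UP.
exists W => // eps eps0; have [F FF] := amen.
have [aX1 aXM _] := aXP; have [_ U_open _] := UP.
have [nU Un] := finite_open_cover_coverable UP.
have [nW Wn] := finite_open_cover_coverable WP.
set l := htop_cover R aG W.
have l0 : 0 <= l := htop_cover_ge0 amen aGP WP.
(* Bounds psi at a singleton for every [V], hence before [V] is chosen. *)
set N1 := cover_number (cover_join aX U [fset 1%g]%fset).
have U1 : coverable (cover_join aX U [fset 1%g]%fset) setT N1.
  have [n1 /cover_numberP[]] := coverable_join_finite aX [fset 1%g]%fset Un.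
  by [].
have M0 : 0 <= ln N1%:R :> R := ln_nat_ge0 _ _.
have lM0 : 0 < l + 2 + ln N1%:R by lra.
(* Since [e * e <= e], the total error is at most [e * (l + 2 + ln N1)]. *)
pose e := Num.min 1 (eps / (l + 2 + ln N1%:R)).
have e0 : 0 < e by rewrite lt_min ltr01 divr_gt0.
have le0 : 0 <= l + e by lra.
have e1 : e <= 1 by rewrite ge_min lexx.
have eeps : (1 + e) * (l + e) + e * ln N1%:R <= l + eps.
  have : e * (l + 2 + ln N1%:R) <= eps.
    by rewrite -ler_pdivlMr // ge_min lexx orbT.
  have : e * e <= e * 1 by rewrite ler_pM2l.
  by lra.
(* Tiles on which [W] has nearly its limiting growth rate; being a tail of any Folner sequence, they
   suffice for quasi-tiling. *)
pose T := [set K |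
  ln (cover_number (cover_join aG W K))%:R <= (l + e) * #|` K|%:R].
have FT : folner_family R T.
  apply: (left_folner_family FF).
  have le : l < l + e by rewrite ltrDl.
  apply: filterS (cvgr_le _ (htop_coverP amen aGP WP FF) _ le) => n.
  by rewrite ler_pdivrMr // ltr0n cardfs_gt0 (proj1 FF).
have [L [LT [D [del [del0 tile]]]]] := quasi_tiling_bound FT e0.
have [||V VP VL] := exists_base_cover U_open fiberUW (L := L)
    (n := fun K => cover_number (cover_join aG W K)).
- by move=> K /LT[].
- by move=> K _; have [n /cover_numberP[]] := coverable_join_finite aG K Wn.
exists V => //.
have [nV Vn] := finite_open_cover_coverable VP.
apply: (ler_cvg_to (htop_coverP amen aXP UP FF)
  (cvgD (htop_coverP amen aYP VP FF) (cvg_cst (l + eps)))).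
near=> n => /=.
have Fn0 : 0 < #|` F n|%:R :> R by rewrite ltr0n cardfs_gt0 (proj1 FF).
rewrite ler_pdivrMr // mulrDl mulfVK ?gt_eqF //.
pose J := join_number aX U (pullback V).
have Jsub := join_number_subadditive aX1 aXM R (pullback V) Un.
have Jn : ln (J (F n))%:R <= (l + eps) * #|` F n|%:R.
  have bn : (boundary D (F n))%:R <= del * #|` F n|%:R.
    by near: n; exact: left_folner_boundary.
  rewrite (le_trans (tile _ bn _ (l + e) (ln N1%:R) Jsub le0 M0 _ _)) //.
  - move=> K KL; have [KT _] := LT K KL; rewrite (le_trans _ KT) //.
    by rewrite ler_ln_nat // VL.
  - rewrite ler_ln_nat // join_number_le // => S _.
    exact: coverableS U1.
  - by rewrite ler_pM2r.
(* What remains is N(U^F) <= N(V^F) psi(F), with [V] pulled back to [X]. *)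
rewrite (le_trans _ (lerD (lexx _) Jn)) // (le_trans _ (ler_ln_natM _ _ _)) //.
rewrite ler_ln_nat //.
have [nV' Vn'] := coverable_join_finite aY (F n) Vn.
have [Vcov _] := cover_numberP Vn'.
have [pVcov pVle] := cover_numberP (coverable_pullback Vcov).
rewrite (leq_trans (cover_number_mul (join_numberP Un) pVcov)) //.
by rewrite leq_mul2r pVle orbT.
Unshelve. all: by end_near.
Qed.

Lemma htop_cover_extension_ge U W : [set: Y] !=set0 -> [set: G] !=set0 ->
  amenable R Gam -> finite_open_cover U -> finite_open_cover W ->
  exists2 Z, finite_open_cover Z &
    htop_cover R aY U + htop_cover R aG W <= htop_cover R aX Z.
Proof.
move=> Y0 G0 amen UP WP; have [Z ZP ZN] := cover_number_mul_extension Y0 G0 UP WP.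
exists Z => //; have [F FF] := amen.
apply: (ler_cvg_to
  (cvgD (htop_coverP amen aYP UP FF) (htop_coverP amen aGP WP FF))
  (htop_coverP amen aXP ZP FF)).
near=> n => /=.
have Fn0 : 0 < #|` F n|%:R :> R by rewrite ltr0n cardfs_gt0 (proj1 FF).
rewrite -mulrDl ler_pM2r ?invr_gt0 //.
(* The logarithm splits because both covering numbers are positive, [Y] and [G] being nonempty. *)
rewrite addrfctE -ln_natM ?ler_ln_nat //.
- have [nU Un] := finite_open_cover_coverable UP.
  have [nU' Un'] := coverable_join_finite aY (F n) Un.
  exact: (cover_number_gt0 Y0 Un').
- have [nU Un] := finite_open_cover_coverable WP.
  have [nU' Un'] := coverable_join_finite aG (F n) Un.
  exact: (cover_number_gt0 G0 Un').
Unshelve. all: by end_near.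
Qed.

End Extension.

(** * Suprema over covers *)

Lemma finite_open_cover_setT (X : topologicalType) :
  finite_open_cover [set [set: X]].
Proof.
by split=> [|A ->|]; [exact: finite_set1|exact: openT|rewrite bigcup_set1].
Qed.

Lemma htop_ge0 (R : realType) (Gam : groupType) (X : topologicalType)
    (a : Gam -> X -> X) :
  amenable R Gam -> continuous_action a -> (0 <= htop R a)%E.
Proof.
move=> amen aP; have UP := finite_open_cover_setT X.
apply: (@le_trans _ _ (htop_cover R a [set setT])%:E).
  by rewrite lee_fin htop_cover_ge0.
by apply: ereal_sup_ubound; exists [set setT].
Qed.

Local Open Scope ereal_scope.

Theorem theorem6p1 (R : realType) (Gam : groupType)
    (X Y G : topologicalType)
    (aX : Gam -> X -> X) (aY : Gam -> Y -> Y) (aG : Gam -> G -> G)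
    (Gam_countable : countable [set: Gam])
    (Gam_amenable : amenable R Gam)
    (X_nonempty : [set: X] !=set0)
    (X_compact : compact [set: X]) (X_metrizable : metrizable R X)
    (Y_compact : compact [set: Y]) (Y_metrizable : metrizable R Y)
    (G_compact : compact [set: G]) (G_metrizable : metrizable R G)
    (aX_action : continuous_action aX)
    (aY_action : continuous_action aY)
    (aG_action : continuous_action aG)
    (extension : is_extension aX aY aG) :
  htop R aX = htop R aY + htop R aG.
Proof.
have [dX dXP] := X_metrizable; have [dY dYP] := Y_metrizable.
have [dG dGP] := G_metrizable.
have [p [m [factor [mc mr mi ma]]]] := extension.
have hY0 := htop_ge0 Gam_amenable aY_action.
have hG0 := htop_ge0 Gam_amenable aG_action.
apply/eqP; rewrite eq_le; apply/andP; split.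
  apply: ge_ereal_sup => _ [U UP <-].
  have [W WP hW] := htop_cover_extension_le dXP dYP dGP X_compact Y_compact
    G_compact aX_action aY_action aG_action factor mc mr ma
    X_nonempty Gam_amenable UP.
  apply/lee_addgt0Pr => eps /hW[V VP hV].
  apply: (@le_trans _ _ (htop_cover R aY V + (htop_cover R aG W + eps))%R%:E).
    by rewrite lee_fin.
  rewrite !EFinD addeA leeD2r // leeD //.
    by apply: ereal_sup_ubound; exists V.
  by apply: ereal_sup_ubound; exists W.
have Y0 : [set: Y] !=set0 by have [x _] := X_nonempty; exists (p x).
have G0 : [set: G] !=set0.
  have [x _] := X_nonempty; have : (p @^-1` [set p x])%classic x by [].
  by rewrite mr => -[g _ _]; exists g.
have hX0 := htop_ge0 Gam_amenable aX_action.
(* An infinite entropy of [X] leaves nothing to prove. *)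
case hX : (htop R aX) hX0 => [r| |] // _; last by rewrite leey.
have UW U W : finite_open_cover U -> finite_open_cover W ->
    (htop_cover R aY U + htop_cover R aG W <= r)%R.
  move=> UP WP; have [Z ZP hZ] := htop_cover_extension_ge dXP dYP dGP X_compact
    Y_compact G_compact aX_action aY_action aG_action factor mc mr mi ma Y0 G0
    Gam_amenable UP WP.
  rewrite (le_trans hZ) // -lee_fin -hX.
  by apply: ereal_sup_ubound; exists Z.
(* The supremum over [W] is taken first; with the trivial cover of [Y] it shows that the entropy of
   [G] is finite and may be subtracted. *)
have hGU U : finite_open_cover U -> htop R aG <= (r - htop_cover R aY U)%R%:E.
  move=> UP; apply: ge_ereal_sup => _ [W WP <-]; rewrite lee_fin.
  by have := UW U W UP WP; lra.
have hGfin : htop R aG \is a fin_num.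
  rewrite ge0_fin_numE // (le_lt_trans (hGU _ (finite_open_cover_setT Y))) //.
  exact: ltry.
rewrite -leeBrDr //; apply: ge_ereal_sup => _ [U UP <-].
rewrite leeBrDr // addeC -leeBrDr //.
exact: hGU.
Qed.
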